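(* Let $(R,\mathfrak{m})$ be a Cohen--Macaulay local ring and $\mathfrak{p}$ a prime ideal of height $g\geq 2$ such that $R_{\mathfrak{p}}$ is a regular local ring. Let $s\geq 2$ be an integer, let $J=(z_1,\ldots,z_g)$ be an ideal generated by a regular sequence $z_1,\ldots,z_g$ contained in $\mathfrak{p}^{(s)}$, and assume that the initial forms of $z_1,\ldots,z_g$ form a regular sequence on $\mathrm{gr}_{\mathfrak{p}}(R)$. Assume moreover that either the height $g$ of $\mathfrak{p}$ is at least $3$, or $g=2$ and $J\subseteq \mathfrak{p}^{(s+1)}$. Then for every $k=1,\ldots,s$ the ideal $I_k=J\colon \mathfrak{p}^{(k)}$ satisfies \[ I_k^2=J I_k . \]
   Context: All rings are commutative and Noetherian. $\mathfrak{p}^{(k)}=\mathfrak{p}^kR_{\mathfrak{p}}\cap R$ denotes the $k$-th symbolic power of $\mathfrak{p}$, and $\mathrm{gr}_{\mathfrak{p}}(R)=\bigoplus_{i\geq 0}\mathfrak{p}^i/\mathfrak{p}^{i+1}$ is the associated graded ring of $\mathfrak{p}$. For $0\neq r\in R$, the initial form of $r$ in $\mathrm{gr}_{\mathfrak{p}}(R)$ is the residue class of $r$ in $\mathfrak{p}^q/\mathfrak{p}^{q+1}$, where $q$ is the integer with $r\in\mathfrak{p}^q$, $r\notin\mathfrak{p}^{q+1}$. For ideals $A,B$, $A\colon B=\{r\in R: rB\subseteq A\}$. *)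

(* Defs.v *)
From HB Require Import structures.
From mathcomp Require Import all_boot all_order all_algebra ring.
From mathcomp Require Import boolp classical_sets.

Set Implicit Arguments.
Unset Strict Implicit.
Unset Printing Implicit Defensive.

Import Order.TTheory GRing.Theory.
Local Open Scope quotient_scope.
Local Open Scope classical_set_scope.
Local Open Scope ring_scope.

(* Ideals are sets; in contrast with [idealr] of ring_quotient, the unit ideal
   is allowed. Prime ideals are the (proper) [prime_idealr] of ring_quotient,
   turned into sets by [set` p]. *)
Section Ideals.
Variable R : comNzRingType.
Implicit Types (A B I J : set R) (s : seq R).

Definition is_ideal I : Prop :=
  [/\ I 0, (forall x y, I x -> I y -> I (x + y)) & (forall a x, I x -> I (a * x))].

Definition ideal_gen A : set R := smallest is_ideal A.

Definition ideal_mul I J : set R := ideal_gen [set x * y | x in I & y in J].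

Fixpoint ideal_pow I (n : nat) : set R :=
  if n is n'.+1 then ideal_mul (ideal_pow I n') I else [set: R].

Definition colon A B : set R := [set r | forall b, B b -> A (r * b)].

Definition is_maximal I : Prop :=
  [/\ is_ideal I, I <> [set: R] &
      forall J, is_ideal J -> I `<=` J -> J = I \/ J = [set: R]].

Definition is_local I : Prop :=
  is_maximal I /\ forall J, is_maximal J -> J = I.

(* x_i is a nonzerodivisor on R/(x_0, ..., x_{i-1}), and R/(x_0, ...) <> 0 *)
Definition regular_seq s : Prop :=
  (forall i a, (i < size s)%N ->
     ideal_gen [set` take i s] (s`_i * a) -> ideal_gen [set` take i s] a)
  /\ ideal_gen [set` s] <> [set: R].

Definition has_depth I (n : nat) : Prop :=
  (exists s, [/\ size s = n, [set` s] `<=` I & regular_seq s]) /\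
  (forall s, [set` s] `<=` I -> regular_seq s -> (size s <= n)%N).

Definition prime_chain (c : nat -> prime_idealr R) (n : nat) : Prop :=
  forall i, (i < n)%N -> [set` c i] `<` [set` c i.+1].

Definition has_height (p : prime_idealr R) (n : nat) : Prop :=
  (exists c, prime_chain c n /\ [set` c n] = [set` p]) /\
  (forall c k, prime_chain c k -> [set` c k] = [set` p] -> (k <= n)%N).

End Ideals.

Definition noetherian (R : comNzRingType) : Prop :=
  forall I : set R, is_ideal I -> exists s : seq R, I = ideal_gen [set` s].

Definition has_krull_dim (R : comNzRingType) (n : nat) : Prop :=
  (exists c : nat -> prime_idealr R, prime_chain c n) /\
  (forall (c : nat -> prime_idealr R) k, prime_chain c k -> (k <= n)%N).

Definition cohen_macaulay_local (R : comNzRingType) (m : set R) : Prop :=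
  [/\ noetherian R, is_local m &
      exists d, has_krull_dim R d /\ has_depth m d].

Definition regular_local (R : comNzRingType) : Prop :=
  noetherian R /\
  exists m : set R, is_local m /\
  exists s : seq R, m = ideal_gen [set` s] /\ has_krull_dim R (size s).

Section IdealTheory.
Variable R : comNzRingType.
Implicit Types (A I J : set R).

Lemma ideal_genP A : is_ideal (ideal_gen A).
Proof.
split=> [I [[]]//|x y hx hy I hI|a x hx I hI].
- by have [[_ D _] _] := hI; apply: D; [exact: hx|exact: hy].
- by have [[_ _ M] _] := hI; apply: M; exact: hx.
Qed.

Lemma ideal_powP I n : is_ideal (ideal_pow I n).
Proof. by case: n => [|n]; [split|exact: ideal_genP]. Qed.

Lemma ideal_pow1 I x : I x -> ideal_pow I 1 x.
Proof. by move=> Ix J [_]; apply; exists 1 => //; exists x; rewrite ?mul1r. Qed.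

Lemma ideal_powS I n : ideal_pow I n.+1 `<=` ideal_pow I n.
Proof.
move=> x; apply; split; first exact: ideal_powP.
move=> _ [a ha [b _ <-]]; have [_ _ M] := ideal_powP I n.
by rewrite mulrC; exact: M.
Qed.

Lemma ideal_powM I m n x y :
  ideal_pow I m x -> ideal_pow I n y -> ideal_pow I (m + n) (x * y).
Proof.
move=> hx; elim: n y => [|n IHn] y hy.
  by rewrite addn0 mulrC; have [_ _ M] := ideal_powP I m; exact: M.
have [P0 PD PM] := ideal_powP I (m + n.+1).
apply: (hy [set y | ideal_pow I (m + n.+1) (x * y)]); split; first split => /=.
- by rewrite mulr0.
- by move=> u v hu hv; rewrite mulrDr; exact: PD.
- by move=> a u hu; rewrite mulrCA; exact: PM.
move=> _ [a ha [b hb <-]] /=; rewrite addnS mulrA => J [_]; apply.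
by exists (x * a); [exact: IHn|exists b].
Qed.

End IdealTheory.

(* R_p, as the quotient of R * (R \ p) by
   a/s = b/t <-> exists u \notin p, u (a t - b s) = 0 *)
Section Localization.
Variables (R : comNzRingType) (p : prime_idealr R).

Definition loc_den : Type := {s : R | s \notin p}.
HB.instance Definition _ := SubChoice.on loc_den.

Lemma loc_den1 : 1 \notin p. Proof. by rewrite idealr1. Qed.

Lemma loc_denM (s t : loc_den) : val s * val t \notin p.
Proof. by rewrite prime_idealrM negb_or (valP s) (valP t). Qed.

Definition locd1 : loc_den := exist (fun s => s \notin p) 1 loc_den1.
Definition locdM (s t : loc_den) : loc_den :=
  exist (fun s => s \notin p) (val s * val t) (loc_denM s t).

Definition loc_rel (x y : R * loc_den) : bool :=
  `[< exists u : loc_den, val u * (x.1 * val y.2 - y.1 * val x.2) = 0 >].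

Lemma loc_rel_equiv : equiv_class_of loc_rel.
Proof.
split=> [[a s]|[a s] [b t]|[b t] [a s] [c r]]; rewrite /loc_rel /=.
- by apply/asboolP; exists locd1 => //=; rewrite subrr mulr0.
- by apply/asboolP/asboolP => -[u /= e]; exists u => //=; rewrite -opprB mulrN e oppr0.
- move=> /asboolP [u /= e] /asboolP [v /= f]; apply/asboolP.
  exists (locdM t (locdM u v)) => //=.
  have -> : val t * (val u * val v) * (a * val r - c * val s) =
    val v * val r * (val u * (a * val t - b * val s))
    + val u * val s * (val v * (b * val r - c * val t)) by ring.
  by rewrite e f !mulr0 addr0.
Qed.

Canonical loc_rel_canonical := EquivRelPack loc_rel_equiv.

Definition loc : Type := {eq_quot loc_rel}.
HB.instance Definition _ := Choice.on loc.
HB.instance Definition _ := EqQuotient.on loc.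

Definition frac (x : R * loc_den) : loc := \pi_loc x.

Lemma fracP x y : frac x = frac y <->
  exists u : loc_den, val u * (x.1 * val y.2 - y.1 * val x.2) = 0.
Proof.
by split=> [/eqmodP/asboolP //|h]; apply/eqmodP; apply/asboolP.
Qed.

Lemma frac_repr (x : loc) : frac (repr x) = x. Proof. exact: reprK. Qed.

Lemma fracW x y : x.1 * val y.2 = y.1 * val x.2 -> frac x = frac y.
Proof. by move=> e; apply/fracP; exists locd1 => //=; rewrite e subrr mulr0. Qed.

Definition loc_add_rep (x y : R * loc_den) :=
  (x.1 * val y.2 + y.1 * val x.2, locdM x.2 y.2).
Definition loc_mul_rep (x y : R * loc_den) := (x.1 * y.1, locdM x.2 y.2).
Definition loc_opp_rep (x : R * loc_den) := (- x.1, x.2).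

Definition loc_add (x y : loc) := frac (loc_add_rep (repr x) (repr y)).
Definition loc_mul (x y : loc) := frac (loc_mul_rep (repr x) (repr y)).
Definition loc_opp (x : loc) := frac (loc_opp_rep (repr x)).

Lemma frac_add x y : loc_add (frac x) (frac y) = frac (loc_add_rep x y).
Proof.
have /fracP [u e] := frac_repr (frac x).
have /fracP [v f] := frac_repr (frac y).
apply/fracP; exists (locdM u v) => //=.
move: (repr (frac x)) (repr (frac y)) e f => [a s] [b t].
case: x y => [a' s'] [b' t'] /= e f.
have -> : val u * val v * ((a * val t + b * val s) * (val s' * val t') -
     (a' * val t' + b' * val s') * (val s * val t)) =
   val v * val t * val t' * (val u * (a * val s' - a' * val s))
   + val u * val s * val s' * (val v * (b * val t' - b' * val t)) by ring.
by rewrite e f !mulr0 addr0.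
Qed.

Lemma frac_mul x y : loc_mul (frac x) (frac y) = frac (loc_mul_rep x y).
Proof.
have /fracP [u e] := frac_repr (frac x).
have /fracP [v f] := frac_repr (frac y).
apply/fracP; exists (locdM u v) => //=.
move: (repr (frac x)) (repr (frac y)) e f => [a s] [b t].
case: x y => [a' s'] [b' t'] /= e f.
have -> : val u * val v * (a * b * (val s' * val t') - a' * b' * (val s * val t)) =
   val v * b * val t' * (val u * (a * val s' - a' * val s))
   + val u * a' * val s * (val v * (b * val t' - b' * val t)) by ring.
by rewrite e f !mulr0 addr0.
Qed.

Lemma frac_opp x : loc_opp (frac x) = frac (loc_opp_rep x).
Proof.
have /fracP [u e] := frac_repr (frac x).
apply/fracP; exists u => //=.
by rewrite !mulNr -opprD mulrN e oppr0.
Qed.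

Lemma frac_ind (P : loc -> Prop) : (forall x, P (frac x)) -> forall x, P x.
Proof. by move=> h x; rewrite -(frac_repr x). Qed.

(* the canonical map R -> R_p *)
Definition loc_of (r : R) : loc := frac (r, locd1).

Lemma loc_addA : associative loc_add.
Proof.
elim/frac_ind=> x; elim/frac_ind=> y; elim/frac_ind=> z.
by rewrite !frac_add; apply: fracW => /=; ring.
Qed.
Lemma loc_addC : commutative loc_add.
Proof.
elim/frac_ind=> x; elim/frac_ind=> y.
by rewrite !frac_add; apply: fracW => /=; ring.
Qed.
Lemma loc_add0 : left_id (loc_of 0) loc_add.
Proof. by elim/frac_ind=> x; rewrite frac_add; apply: fracW => /=; ring. Qed.
Lemma loc_addN : left_inverse (loc_of 0) loc_opp loc_add.
Proof.
by elim/frac_ind=> x; rewrite frac_opp frac_add; apply: fracW => /=; ring.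
Qed.
HB.instance Definition _ :=
  GRing.isZmodule.Build loc loc_addA loc_addC loc_add0 loc_addN.

Lemma loc_mulA : associative loc_mul.
Proof.
elim/frac_ind=> x; elim/frac_ind=> y; elim/frac_ind=> z.
by rewrite !frac_mul; apply: fracW => /=; ring.
Qed.
Lemma loc_mulC : commutative loc_mul.
Proof.
elim/frac_ind=> x; elim/frac_ind=> y.
by rewrite !frac_mul; apply: fracW => /=; ring.
Qed.
Lemma loc_mul1 : left_id (loc_of 1) loc_mul.
Proof. by elim/frac_ind=> x; rewrite frac_mul; apply: fracW => /=; ring. Qed.
Lemma loc_mulD : left_distributive loc_mul loc_add.
Proof.
elim/frac_ind=> x; elim/frac_ind=> y; elim/frac_ind=> z.
by rewrite !(frac_add, frac_mul); apply: fracW => /=; ring.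
Qed.
Lemma loc1_neq0 : loc_of 1 != loc_of 0.
Proof.
apply/eqP => /fracP [[u hu]] /=; rewrite !mulr1 subr0 mulr1 => e.
by move: hu; rewrite e idealr0.
Qed.
HB.instance Definition _ := GRing.Zmodule_isComNzRing.Build loc
  loc_mulA loc_mulC loc_mul1 loc_mulD loc1_neq0.

(* p^(k) = p^k R_p \cap R *)
Definition symbolic_pow (k : nat) : set R :=
  loc_of @^-1` (ideal_gen (loc_of @` ideal_pow [set` p] k)).

End Localization.

(* gr_p(R) = (\bigoplus_i p^i) / (\bigoplus_i p^(i+1)), where \bigoplus_i p^i is
   represented by the Rees subring {f | f`_i \in p^i} of {poly R} *)
Section AssociatedGraded.
Variables (R : comNzRingType) (p : idealr R).

Let P := ideal_pow [set` p].

Definition rees_pred : {pred {poly R}} := 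
  [pred f : {poly R} | `[< forall i, P i f`_i >]].

Lemma rees_pred_subring : subring_closed rees_pred.
Proof.
split=> [|f g|f g].
- apply/asboolP => i; rewrite coef1; have [P0 _ _] := ideal_powP [set` p] i.
  by case: i P0.
- move=> /asboolP hf /asboolP hg; apply/asboolP => i.
  have [_ PD PM] := ideal_powP [set` p] i.
  by rewrite coefB -mulN1r; apply: (PD _ _ (hf i)); exact: PM (hg i).
- move=> /asboolP hf /asboolP hg; apply/asboolP => i.
  have [P0 PD _] := ideal_powP [set` p] i.
  rewrite coefM; elim/big_ind: _ => // j _.
  by have := ideal_powM (hf j) (hg (i - j)%N); rewrite subnKC // -ltnS.
Qed.

HB.instance Definition _ :=
  GRing.isSubringClosed.Build _ rees_pred rees_pred_subring.

Definition rees : Type := {f : {poly R} | f \in rees_pred}.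
HB.instance Definition _ := SubChoice.on rees.
HB.instance Definition _ := [SubChoice_isSubComNzRing of rees by <:].

Definition gr_ker : {pred rees} := 
  [pred f : rees | `[< forall i, P i.+1 (val f)`_i >]].

Lemma gr_ker_ideal : idealr_closed gr_ker.
Proof.
have C i := ideal_powP [set` p] i.
split=> [||a f g].
- by apply/asboolP => i; rewrite raddf0 coef0; have [] := C i.+1.
- apply/asboolP => /(_ 0%N); rewrite rmorph1 coef1 /= => h.
  suff : 1 \in p by rewrite idealr1.
  apply: (h [set` p]); split; first split => /=.
  + exact: idealr0.
  + by move=> x y; exact: rpredD.
  + by move=> b x; exact: idealMr.
  by move=> _ [b _ [x hx <-]] /=; exact: idealMr.
- move=> /asboolP hf /asboolP hg; apply/asboolP => i.
  have [P0 PD _] := C i.+1.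
  rewrite rmorphD rmorphM coefD; apply: (PD _ _ _ (hg i)).
  rewrite coefM; apply: (big_ind _ P0 PD) => j _.
  have /asboolP ha := valP a.
  by have := ideal_powM (ha j) (hf (i - j)%N); rewrite addnS subnKC // -ltnS.
Qed.

HB.instance Definition _ := isIdealr.Build _ gr_ker gr_ker_ideal.

Definition gr : Type := {ideal_quot gr_ker}.
HB.instance Definition _ := GRing.ComNzRing.on gr.

(* the residue class of r in the component p^q/p^(q+1) of gr, if r \in p^q
   (and 0 otherwise) *)
Definition gr_class (q : nat) (r : R) : gr :=
  \pi_{ideal_quot gr_ker} (insubd (0 : rees) (r *: 'X^q)).

(* If r lies in every p^q, the default 0 makes [initial_form r] the class of
   r \in p in R/p, that is 0. *)
Definition p_order (r : R) : nat := xget 0%N [set q | P q r /\ ~ P q.+1 r].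

Definition initial_form (r : R) : gr := gr_class (p_order r) r.

End AssociatedGraded.

(* Main.v *)
Require Import Defs.
From HB Require Import structures.
From mathcomp Require Import all_boot all_order all_algebra.
From mathcomp Require Import boolp classical_sets ring zify.

(* Write A = R_p, F_d = p^d A, let q_l be the p-adic order of z_l and y_l its
   initial form, and let N_i(d) be the sum of F_(d+1) and of the z_l F_(d-q_l),
   l < i, so that F_d / N_i(d) is the degree d part of gr(A) / (y_0, ..., y_(i-1)).
   As pA is generated by g elements x, and the regular sequence y has length g,
   the Koszul homology H_j(x; gr(A) / (y_0, ..., y_(i-1))) vanishes for j > i, and
   for j = i it lives in degrees >= q_0 + ... + q_(i-1). For i = j = g this says
   that the socle of gr(A) / (y) lives in degrees >= q_0 + ... + q_(g-1) - g.
   Hence JA : F_k lies in JA + F_e as soon as e + k + g <= q_0 + ... + q_(g-1) + 1,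
   and the hypotheses on g and s allow e = max q_l. It follows that I_k p^(k) lies
   in J p^(k) and then, the relations of z having their coefficients in J, that
   I_k^2 = J I_k. Everything descends from A to R because p^(k) is p-primary. *)

Set Implicit Arguments.
Unset Strict Implicit.
Unset Printing Implicit Defensive.

Import GRing.Theory.
Local Open Scope classical_set_scope.
Local Open Scope ring_scope.

(** * Ideals *)

Section IdealFacts.
Variable R : comNzRingType.
Implicit Types (I B : set R) (h : nat -> R).

Lemma is_ideal0 I : is_ideal I -> I 0. Proof. by case. Qed.

Lemma is_idealD I x y : is_ideal I -> I x -> I y -> I (x + y).
Proof. by case=> _ D _; exact: D. Qed.

Lemma is_idealM I a x : is_ideal I -> I x -> I (a * x).
Proof. by case=> _ _ M; exact: M. Qed.

Lemma is_idealN I x : is_ideal I -> I x -> I (- x).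
Proof. by move=> idI Ix; rewrite -mulN1r; exact: is_idealM. Qed.

Lemma is_idealB I x y : is_ideal I -> I x -> I y -> I (x - y).
Proof. by move=> idI Ix Iy; apply: is_idealD => //; exact: is_idealN. Qed.

Lemma is_ideal_sum I (n : nat) (f : nat -> R) : is_ideal I ->
  (forall l, (l < n)%N -> I (f l)) -> I (\sum_(l < n) f l).
Proof.
move=> idI If; elim/big_ind: _ => [|x y|l _]; first exact: is_ideal0.
  exact: is_idealD.
exact: If.
Qed.

Lemma set0_ideal : is_ideal [set (0 : R)].
Proof. by split=> [//|_ _ -> ->|a _ ->] /=; rewrite ?addr0 ?mulr0. Qed.

Lemma setT_ideal : is_ideal [set: R].
Proof. by []. Qed.

Lemma sub_ideal_gen I : I `<=` ideal_gen I.
Proof. by move=> x Ix J [_]; exact. Qed.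

Lemma ideal_gen_min I B : is_ideal I -> B `<=` I -> ideal_gen B `<=` I.
Proof. by move=> idI BI x; apply. Qed.

(* B + h_0 D_0 + ... + h_(i-1) D_(i-1) *)
Fixpoint lin h B (D : nat -> set R) (i : nat) : set R :=
  if i is i'.+1 then
    [set y | exists a b, [/\ lin h B D i' a, D i' b & y = a + h i' * b]]
  else B.

Lemma linP h B D i y : lin h B D i y <-> exists b : nat -> R,
  (forall l, (l < i)%N -> D l (b l)) /\ B (y - \sum_(l < i) h l * b l).
Proof.
elim: i y => [|i IHi] y /=.
  split=> [By|[b [_]]]; last by rewrite big_ord0 subr0.
  by exists (fun=> 0); rewrite big_ord0 subr0.
split=> [[a [c [/IHi [b [Db Bb]] Dc ->]]]|[b [Db Bb]]].
  exists (fun l => if l == i then c else b l); split=> [l|].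
    by rewrite ltnS leq_eqVlt; case: eqVneq => [-> _|_ /Db].
  rewrite big_ord_recr /= eqxx (eq_bigr (fun l : 'I_i => h l * b l)) => [|l _].
    by rewrite opprD addrACA subrr addr0.
  by rewrite ltn_eqF.
exists (y - h i * b i), (b i); split; last by rewrite subrK.
  apply/IHi; exists b; split=> [l li|]; first by apply: Db; exact: ltnW.
  by move: Bb; rewrite big_ord_recr /= opprD addrA addrAC.
exact: Db.
Qed.

Lemma lin_ideal h B D i : is_ideal B ->
  (forall l, (l < i)%N -> is_ideal (D l)) -> is_ideal (lin h B D i).
Proof.
move=> idB; elim: i => [//|i IHi] idD.
have idDi := idD i (ltnSn i).
have idi : is_ideal (lin h B D i) by apply: IHi => l li; apply: idD; exact: ltnW.
split=> [|_ _ [a [b [ha hb ->]]] [c [d [hc hd ->]]]|r _ [a [b [ha hb ->]]]].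
- exists 0, 0; rewrite mulr0 addr0; split=> //; exact: is_ideal0.
- exists (a + c), (b + d); rewrite mulrDr addrACA.
  by split=> //; exact: is_idealD.
- exists (r * a), (r * b); rewrite mulrDr mulrCA.
  by split=> //; exact: is_idealM.
Qed.

Lemma lin_sub h B B' D D' i : B `<=` B' ->
  (forall l, (l < i)%N -> D l `<=` D' l) -> lin h B D i `<=` lin h B' D' i.
Proof.
move=> BB'; elim: i => [//|i IHi] DD' y [a [b [ha hb ->]]].
exists a, b; split=> //; last exact: DD' hb.
by apply: IHi ha => l li; apply: DD'; exact: ltnW.
Qed.

Lemma sub_lin h B D i :
  (forall l, (l < i)%N -> D l 0) -> B `<=` lin h B D i.
Proof.
move=> D0 y By; apply/linP; exists (fun=> 0); split=> //.
by rewrite big1 ?subr0 // => l _; rewrite mulr0.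
Qed.

Lemma lin_min h B D i I : is_ideal I -> B `<=` I ->
  (forall l b, (l < i)%N -> D l b -> I (h l * b)) -> lin h B D i `<=` I.
Proof.
move=> idI BI DI y /linP [b [Db Bb]].
rewrite -(subrK (\sum_(l < i) h l * b l) y); apply: is_idealD => //.
  exact: BI.
by apply: (is_ideal_sum (f := fun l => h l * b l)) => // l li; exact: DI (Db _ li).
Qed.

Lemma lin_gen h B D i l b : is_ideal B ->
  (forall k, (k < i)%N -> is_ideal (D k)) -> (l < i)%N -> D l b ->
  lin h B D i (h l * b).
Proof.
move=> idB idD li Db; apply/linP; exists (fun k => if k == l then b else 0).
split=> [k ki|]; first by case: eqVneq => [->|_]//; exact: is_ideal0 (idD _ ki).
rewrite (bigD1 (Ordinal li)) //= eqxx big1 ?addr0 ?subrr; first exact: is_ideal0.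
by move=> k kl; rewrite -[k == l :> nat]/(k == Ordinal li) (negPf kl) mulr0.
Qed.

End IdealFacts.

(** * Koszul complexes *)

Section Koszul.
Variables (A : comNzRingType) (x : nat -> A).

(* The total exterior algebra on n generators: a pair (u, v) stands for
   u + e_n v, where u and v do not involve the last generator e_n. *)
Fixpoint kos (n : nat) : lmodType A :=
  if n is n'.+1 then (kos n' * kos n')%type else A^o.

Unset Implicit Arguments.
(** The antiderivation sending e_l to x_l, whence e_n v goes to x_n v - e_n d(v). *)
Fixpoint kosd (n : nat) : kos n -> kos n :=
  match n with
  | 0 => fun _ => 0
  | n'.+1 => fun u => (kosd n' u.1 + x n' *: u.2, - kosd n' u.2)
  end.

(** Left multiplication by the form a_0 e_0 + ... + a_(n-1) e_(n-1). *)
Fixpoint wedge (a : nat -> A) (n : nat) : kos n -> kos n :=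
  match n with
  | 0 => fun _ => 0
  | n'.+1 => fun u => (wedge a n' u.1, a n' *: u.1 - wedge a n' u.2)
  end.

Set Implicit Arguments.

Lemma kos_ext n (u v : kos n.+1) : u.1 = v.1 -> u.2 = v.2 -> u = v.
Proof. by case: u v => [? ?] [? ?] /= -> ->. Qed.

Lemma kosdD n (u v : kos n) : kosd n (u + v) = kosd n u + kosd n v.
Proof.
elim: n u v => [|n IHn] u v /=; first by rewrite addr0.
by apply: (@kos_ext _ _ _); rewrite /= IHn ?scalerDr ?opprD // addrACA.
Qed.

Lemma kosdZ n a (u : kos n) : kosd n (a *: u) = a *: kosd n u.
Proof.
elim: n u => [|n IHn] u /=; first by rewrite scaler0.
by apply: (@kos_ext _ _ _); rewrite /= IHn ?scalerDr ?scalerN // !scalerA mulrC.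
Qed.

Lemma kosdN n (u : kos n) : kosd n (- u) = - kosd n u.
Proof. by rewrite -scaleN1r kosdZ scaleN1r. Qed.

Lemma kosdB n (u v : kos n) : kosd n (u - v) = kosd n u - kosd n v.
Proof. by rewrite kosdD kosdN. Qed.

Lemma kosd0 n : kosd n 0 = 0.
Proof. by have := kosdZ 0 (0 : kos n); rewrite !scale0r. Qed.

Lemma kosdK n (u : kos n) : kosd n (kosd n u) = 0.
Proof.
elim: n u => [//|n IHn] u /=.
apply: (@kos_ext _ _ _); rewrite /= ?kosdD ?kosdN ?kosdZ ?IHn ?opprK //.
by rewrite scalerN add0r subrr.
Qed.

(** As d is an antiderivation, [wedge a] is a homotopy from 0 to multiplication by the sum of the
    a_l x_l, which thus kills Koszul homology. *)
Lemma kosd_wedge a n (u : kos n) :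
  kosd n (wedge a n u) + wedge a n (kosd n u) = (\sum_(l < n) a l * x l) *: u.
Proof.
elim: n u => [|n IHn] u; first by rewrite big_ord0 scale0r addr0.
have wD (v w : kos n) : wedge a n (v + w) = wedge a n v + wedge a n w.
  elim: (n) v w => [|k IHk] v w /=; first by rewrite addr0.
  by apply: (@kos_ext _ _ _); rewrite /= IHk // scalerDr opprD addrACA.
have wZ b (v : kos n) : wedge a n (b *: v) = b *: wedge a n v.
  elim: (n) v => [|k IHk] v /=; first by rewrite scaler0.
  by apply: (@kos_ext _ _ _); rewrite /= IHk // scalerBr !scalerA mulrC.
have wN (v : kos n) : wedge a n (- v) = - wedge a n v.
  by rewrite -scaleN1r wZ scaleN1r.
rewrite big_ord_recr; apply: (@kos_ext _ _ _) => /=; rewrite scalerDl -IHn.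
- rewrite wD wZ scalerBr !scalerA (mulrC (x n)).
  by rewrite addrACA subrK.
- rewrite kosdB kosdZ wN scalerDr scalerA opprB opprK.
  by rewrite -!addrA; congr (_ + _); rewrite addKr addrC.
Qed.

Unset Implicit Arguments.
(* Elements of exterior degree j with all coefficients in I. *)
Fixpoint chain (n j : nat) (I : set A) : kos n -> Prop :=
  match n with
  | 0 => fun u => if j is _.+1 then u = 0 else I u
  | n'.+1 => fun u => chain n' j I u.1 /\
      (if j is j'.+1 then chain n' j' I u.2 else u.2 = 0)
  end.

Set Implicit Arguments.

Lemma chain_sub {n} j I I' u : I `<=` I' -> chain n j I u -> chain n j I' u.
Proof.
move=> II'; elim: n j u => [|n IHn] [|j] u //=; first exact: II'.
  by move=> [/IHn].
by move=> [/IHn ? /IHn].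
Qed.

Lemma chainD {n j I u v} : is_ideal I ->
  chain n j I u -> chain n j I v -> chain n j I (u + v).
Proof.
move=> idI; elim: n j u v => [|n IHn] [|j] u v /=.
- exact: is_idealD.
- by move=> -> ->; rewrite addr0.
- by move=> [u1 ->] [v1 ->]; rewrite addr0; split=> //; exact: IHn.
- by move=> [u1 u2] [v1 v2]; split; exact: IHn.
Qed.

Lemma chainZ {n j I} I' a u : (forall b, I b -> I' (a * b)) ->
  chain n j I u -> chain n j I' (a *: u).
Proof.
move=> II'; elim: n j u => [|n IHn] [|j] u /=.
- exact: II'.
- by move=> ->; rewrite scaler0.
- by move=> [u1 ->]; rewrite scaler0; split=> //; exact: IHn.
- by move=> [u1 u2]; split; exact: IHn.
Qed.

Lemma chainN {n j I u} : is_ideal I -> chain n j I u -> chain n j I (- u).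
Proof.
by move=> idI; rewrite -scaleN1r; apply: chainZ => b; exact: is_idealM.
Qed.

Lemma chainB {n j I u v} : is_ideal I ->
  chain n j I u -> chain n j I v -> chain n j I (u - v).
Proof. by move=> idI hu /(chainN idI); exact: chainD. Qed.

Lemma chain0 n j I : is_ideal I -> chain n j I 0.
Proof.
move=> idI; elim: n j => [|n IHn] [|j] //=; exact: is_ideal0.
Qed.

Lemma chain_eq0 n j I u : (n < j)%N -> chain n j I u -> u = 0.
Proof.
elim: n j u => [|n IHn] [|j] u //= nj [/IHn u1 /IHn u2].
by rewrite [u]surjective_pairing u1 ?u2 //; exact: ltnW.
Qed.

Lemma kosd_chain0 n I u : chain n 0 I u -> kosd n u = 0.
Proof.
elim: n u => [//|n IHn] u /= [/IHn -> ->].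
by rewrite scaler0 addr0 kosd0 oppr0.
Qed.

Lemma kosd_chain {n j I} I' u : is_ideal I' ->
  (forall l b, (l < n)%N -> I b -> I' (x l * b)) ->
  chain n j.+1 I u -> chain n j I' (kosd n u).
Proof.
move=> idI'; elim: n j u => [|n IHn] j u II' /=; first by move=> _; exact: (@chain0 0).
have II'n l b : (l < n)%N -> I b -> I' (x l * b) by move/ltnW/II'; exact.
move=> [u1 u2]; split.
  by apply: chainD (IHn _ _ II'n u1) _ => //; apply: chainZ u2 => b; exact: II'.
case: j {u1} u2 => [|j] u2; last exact: (chainN idI' (IHn _ _ II'n u2)).
by rewrite (kosd_chain0 u2) oppr0.
Qed.

Lemma wedge0 a n : wedge a n 0 = 0.
Proof.
elim: n => [//|n IHn]; apply: (@kos_ext _ _ _) => //=.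
by rewrite IHn scaler0 subr0.
Qed.

Lemma wedge_chain {n j I} I' a u : is_ideal I' ->
  (forall l b, (l < n)%N -> I b -> I' (a l * b)) ->
  chain n j I u -> chain n j.+1 I' (wedge a n u).
Proof.
move=> idI'; elim: n j u => [|n IHn] j u //= II' [u1 u2].
have II'n l b : (l < n)%N -> I b -> I' (a l * b) by move/ltnW/II'; exact.
split; first exact: IHn.
apply: chainB => //; first by apply: chainZ u1 => b; exact: II'.
case: j {u1} u2 => [|j] u2; last exact: IHn.
rewrite u2 wedge0; exact: chain0.
Qed.

Lemma chain_split n j (B D E : set A) t u : is_ideal B -> is_ideal D ->
  (forall y, E y -> exists a b, [/\ B a, D b & y = a + t * b]) ->
  chain n j E u ->
  exists v w, [/\ chain n j B v, chain n j D w & u = v + t *: w].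
Proof.
move=> idB idD dec; elim: n j u => [|n IHn] [|j] u /=.
- exact: dec.
- by move=> ->; exists 0, 0; rewrite scaler0 addr0.
- move=> [/IHn [v [w [hv hw e]]] u2]; exists (v, 0), (w, 0); split=> //=.
  by apply: (@kos_ext _ _ _) => //=; rewrite u2 scaler0 addr0.
- move=> [/IHn [v [w [hv hw e]]] /IHn [v' [w' [hv' hw' e']]]].
  exists (v, v'), (w, w'); split=> //=.
  exact: (@kos_ext _ _ _).
Qed.

Lemma chain_nzd n j (B D E : set A) t u :
  (forall f, D f -> B (t * f) -> E f) ->
  chain n j D u -> chain n j B (t *: u) -> chain n j E u.
Proof.
move=> nzd; elim: n j u => [|n IHn] [|j] u //=; first exact: nzd.
  by move=> [u1 u2] [tu1 _]; split=> //; exact: IHn.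
by move=> [u1 u2] [tu1 tu2]; split; exact: IHn.
Qed.

Unset Implicit Arguments.
(** The top form f e_(n-1) ... e_0. Its differential has the coefficients x_l f up to sign, so it is
    a cycle exactly when f is in the socle. *)
Fixpoint kostop (f : A) (n : nat) : kos n :=
  if n is n'.+1 then (0, kostop f n') else f.

Set Implicit Arguments.

Lemma chain_kostop n (I : set A) f : is_ideal I ->
  chain n n I (kostop f n) <-> I f.
Proof.
move=> idI; elim: n => [//|n IHn] /=; split=> [[_ /IHn]//|/IHn ?]; split=> //.
exact: chain0.
Qed.

Lemma scale_kostop n a f : a *: kostop f n = kostop (a * f) n.
Proof.
elim: n => [//|n IHn]; apply: (@kos_ext _ _ _) => //=; exact: scaler0.
Qed.

Lemma kosd_kostop n (I : set A) f : is_ideal I ->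
  (forall l, (l < n.+1)%N -> I (x l * f)) ->
  chain n.+1 n I (kosd n.+1 (kostop f n.+1)).
Proof.
move=> idI; elim: n => [|n IHn] xf.
  by split=> /=; [rewrite add0r; exact: xf | rewrite oppr0].
split; last by apply: chainN => //; apply: IHn => l /ltnW; exact: xf.
change (chain n.+1 n.+1 I (kosd n.+1 0 + x n.+1 *: kostop f n.+1)).
by rewrite kosd0 add0r scale_kostop; apply/chain_kostop => //; exact: xf.
Qed.

End Koszul.

Arguments kosd {A}.
Arguments wedge {A}.
Arguments chain {A}.
Arguments kostop {A}.

(** * Regular sequences of initial forms *)

Lemma pred_case (Q : nat -> Prop) i :
  (forall j, i = j.+1 -> Q j) -> if i is j.+1 then Q j else True.
Proof. by case: i => // j; exact. Qed.

Section Socle.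
Variables (A : comNzRingType) (F : nat -> set A) (g : nat).
Variables (h x : nat -> A) (q : nat -> nat).
Hypotheses (idF : forall d, is_ideal (F d)) (F0 : F 0 = [set: A])
  (FS : forall d, F d.+1 `<=` F d)
  (FM : forall c d a b, F c a -> F d b -> F (c + d)%N (a * b)).

(* The truncated subtraction is harmless: if d < q l then h l * F 0 is already
   contained in F d.+1. The same holds for F d.-1 below, where F (-1) should be A. *)
Local Notation N i d := (lin h (F d.+1) (fun l => F (d - q l)%N) i).

(** [nzd] says, with elements in place of classes, that the class of h_i in degree q_i is a
    nonzerodivisor modulo the previous ones. *)
Hypotheses (q_gt0 : forall i, (i < g)%N -> (0 < q i)%N)
  (xF : forall l, (l < g)%N -> F 1 (x l))
  (hx : forall i, (i < g)%N -> exists2 a : nat -> A,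
     forall l, F (q i).-1 (a l) & h i = \sum_(l < g) a l * x l)
  (nzd : forall i d f, (i < g)%N -> F d f ->
     N i (d + q i)%N (h i * f) -> N i d f).

Lemma filtration_le d e : (d <= e)%N -> F e `<=` F d.
Proof.
move=> /subnKC <-; elim: (e - d)%N => [|n IHn]; first by rewrite addn0.
by rewrite addnS; apply: subset_trans IHn; exact: FS.
Qed.

Lemma filtration_h i : (i < g)%N -> F (q i) (h i).
Proof.
move=> ig; have [a Fa ->] := hx ig.
apply: (is_ideal_sum (f := fun l => a l * x l)) => // l lg.
by rewrite -(prednK (q_gt0 ig)) -addn1; apply: FM => //; exact: xF.
Qed.

Lemma lin_filtration_ideal i d : is_ideal (N i d).
Proof. exact: lin_ideal. Qed.
Let idN := lin_filtration_ideal.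

Lemma sub_lin_filtration i d : F d.+1 `<=` N i d.
Proof. by apply: sub_lin => l _; exact: is_ideal0. Qed.

Lemma lin_filtrationS i d : N i d `<=` N i.+1 d.
Proof.
by move=> y Ny; exists y, 0; rewrite mulr0 addr0; split=> //; exact: is_ideal0.
Qed.

Lemma lin_filtrationM i c d a y : F c a -> N i d y -> N i (c + d)%N (a * y).
Proof.
move=> Fa; elim: i y => [|i IHi] y /=; first by rewrite -addnS; exact: FM.
move=> [u [v [/IHi Nu Fv ->]]]; exists (a * u), (a * v).
split; [by []| |by rewrite mulrDr mulrCA].
apply: filtration_le (FM Fa Fv); lia.
Qed.

Lemma lin_filtrationX i d l y : (l < g)%N -> N i d y -> N i d.+1 (x l * y).
Proof. by move=> lg; exact: (@lin_filtrationM i 1) (xF lg). Qed.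

(* Since h i = \sum a_l x_l acts as zero on Koszul homology, the connecting map
   embeds H_j(x; gr / (h_0 .. h_(i-1))) into H_(j+1)(x; gr / (h_0 .. h_i)), and the
   exterior degrees stop at g. *)
Lemma koszul_exact i j d c : (i <= g)%N -> (i <= j)%N ->
  chain g j.+1 (F d) c -> chain g j (N i d.+1) (kosd x g c) ->
  exists u, chain g j.+2 (F d.-1) u /\ chain g j.+1 (N i d) (c - kosd x g u).
Proof.
move=> /subnKC; move: (g - i)%N => t.
elim: t i j d c => [|t IHt] i j d c.
  rewrite addn0 => -> gj Fc _.
  rewrite (chain_eq0 _ Fc) //.
  by exists 0; rewrite kosd0 subr0; split; exact: chain0.
move=> it ij Fc Ndc; have ig : (i < g)%N by lia.
have [a Fa ha] := hx ig; have q0 := q_gt0 ig.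
(* By the homotopy, d(e) is h_i c minus the wedge of d(c). So e is a cycle modulo N_(i+1), and the
   induction applies to it. *)
set d' := ((q i).-1 + d)%N; set e := wedge a g c.
have de : kosd x g e = h i *: c - wedge a g (kosd x g c).
  by rewrite ha -kosd_wedge addrK.
have Fe : chain g j.+2 (F d') e.
  by apply: wedge_chain Fc => // l b _ Fb; exact: FM.
have Nwdc : chain g j.+1 (N i d'.+1) (wedge a g (kosd x g c)).
  apply: wedge_chain Ndc => // l b _ Nb.
  by rewrite -[d'.+1]addnS; exact: lin_filtrationM.
have Nde : chain g j.+1 (N i.+1 d'.+1) (kosd x g e).
  rewrite de; apply: chainB => //; last first.
    by apply: chain_sub Nwdc; exact: lin_filtrationS.
  apply: chainZ Fc => b Fb; exists 0, b; rewrite add0r; split=> //.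
    exact: is_ideal0.
  by have -> : (d'.+1 - q i = d)%N by rewrite /d'; lia.
have [||u [Fu Neu]] := IHt i.+1 j.+1 d' e _ _ Fe Nde; [lia|lia|].
have [w [v [Nw Fv euE]]] : exists w v, [/\ chain g j.+2 (N i d') w,
    chain g j.+2 (F (d' - q i)%N) v & e - kosd x g u = w + h i *: v].
  exact: chain_split Neu.
have Fv' : chain g j.+2 (F d.-1) v.
  by have -> : (d.-1 = d' - q i)%N by rewrite /d'; lia.
(* Applying d to e - d(u) = w + h_i v shows that h_i (c - d(v)) is d(w) plus the wedge of d(c). This
   lies in N_i, and regularity cancels h_i. *)
exists v; split=> //.
apply: (chain_nzd (t := h i) (D := F d) (B := N i (d + q i)%N)) => [f||].
- exact: nzd.
- apply: chainB => //; apply: kosd_chain Fv' => // l b lg Fb.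
  by apply: filtration_le (FM (xF lg) Fb); lia.
have -> : h i *: (c - kosd x g v) = kosd x g w + wedge a g (kosd x g c).
  have -> : w = e - kosd x g u - h i *: v by rewrite euE addrK.
  rewrite !kosdB kosdK subr0 kosdZ de scalerBr.
  by rewrite addrAC subrK.
have -> : (d + q i = d'.+1)%N by rewrite /d'; lia.
apply: chainD => //; apply: kosd_chain Nw => // l b lg Nb.
exact: lin_filtrationX.
Qed.

(* As H_i(x; gr / (h_0 .. h_(i-2))) = 0, the connecting map embeds
   H_i(x; gr / (h_0 .. h_(i-1))) into H_(i-1)(x; gr / (h_0 .. h_(i-2))), lowering the
   internal degree by q_(i-1). *)
Lemma koszul_low_degree i d c : (i <= g)%N -> (d + i < \sum_(l < i) q l)%N ->
  chain g i (F d) c ->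
  (if i is j.+1 then chain g j (N i d.+1) (kosd x g c) else True) ->
  exists u, chain g i.+1 (F d.-1) u /\ chain g i (N i d) (c - kosd x g u).
Proof.
elim: i d c => [|i IHi] d c ig; first by rewrite big_ord0.
rewrite big_ord_recr /= => dlt Fc Ndc; have q0 := q_gt0 ig.
have hi := filtration_h ig.
(* If q_i > d + 1, all multiples of h_i lie in F_(d+2), so c is already a cycle modulo N_i. *)
have [dq|qd] := ltnP d.+1 (q i).
  have Ndc' : chain g i (N i d.+1) (kosd x g c).
    apply: chain_sub Ndc => _ [a [b [Na _ ->]]]; apply: is_idealD => //.
    apply: sub_lin_filtration; apply: filtration_le dq _ _.
    by rewrite mulrC; exact: is_idealM.
  have [u [Fu Nu]] := koszul_exact (ltnW ig) (leqnn i) Fc Ndc'.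
  by exists u; split=> //; apply: chain_sub Nu; exact: lin_filtrationS.
(* Here b represents the image of c under the connecting map; it is a cycle modulo N_i because h_i
   d(b) = - d(w). *)
have [w [b [Nw Fb dcE]]] : exists w b, [/\ chain g i (N i d.+1) w,
    chain g i (F (d.+1 - q i)%N) b & kosd x g c = w + h i *: b].
  exact: chain_split Ndc.
set d' := (d.+1 - q i)%N in Fb.
have [||e [Fe Nbe]] := IHi d' b (ltnW ig) _ Fb.
  by move: dlt; rewrite /d'; move: (\sum_(_ < i) _)%N => S; lia.
  apply: (pred_case (Q := fun j => chain g j (N i d'.+1) (kosd x g b))) => j ij.
  apply: (chain_nzd (t := h i) (D := F d'.+1) (B := N i (d'.+1 + q i)%N)).
  - by move=> f; exact: nzd.
  - rewrite ij in Fb; apply: kosd_chain Fb => // l a lg Fa.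
    by rewrite -add1n; apply: FM => //; exact: xF.
  - have -> : h i *: kosd x g b = - kosd x g w.
      have -> : w = kosd x g c - h i *: b by rewrite dcE addrK.
      by rewrite kosdB kosdK sub0r opprK kosdZ.
    have -> : (d'.+1 + q i = d.+2)%N by rewrite /d'; lia.
    rewrite {1}ij in Nw; apply: chainN => //; apply: kosd_chain Nw => // l a lg Na.
    exact: lin_filtrationX.
(* As b = d(e) modulo N_i, subtracting h_i e turns c into a cycle modulo N_i, and h_i e vanishes
   modulo N_(i+1). *)
have Fc' : chain g i.+1 (F d) (c - h i *: e).
  apply: chainB => //; apply: chainZ Fe => a Fa.
  by apply: filtration_le (FM hi Fa); rewrite /d'; lia.
have Nc' : chain g i (N i d.+1) (kosd x g (c - h i *: e)).
  rewrite kosdB kosdZ dcE -addrA -scalerBr; apply: chainD => //.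
  apply: chainZ Nbe => a Na.
  have -> : d.+1 = (q i + d')%N by rewrite /d'; lia.
  exact: lin_filtrationM.
have [u [Fu Nu]] := koszul_exact (ltnW ig) (leqnn i) Fc' Nc'.
exists u; split=> //.
have -> : c - kosd x g u = (c - h i *: e - kosd x g u) + h i *: e.
  by rewrite addrAC subrK.
rewrite -[X in chain _ _ X]/(N i.+1 d).
apply: chainD => //; first by apply: chain_sub Nu; exact: lin_filtrationS.
apply: chainZ Fe => a Fa; exists 0, a; rewrite add0r; split=> //.
  exact: is_ideal0.
by have <- : (d'.-1 = d - q i)%N by rewrite /d'; lia.
Qed.

(** The top form on f is a cycle modulo N_g, hence in this range a boundary; but there are no forms
    of degree g + 1. *)
Lemma socle_low_degree d f : (d + g < \sum_(l < g) q l)%N -> F d f ->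
  (forall l, (l < g)%N -> N g d.+1 (x l * f)) -> N g d f.
Proof.
move=> dg Ff xf.
have g0 : (0 < g)%N by rewrite lt0n; apply: contraTneq dg => ->; rewrite big_ord0.
have [||u [Fu Nu]] := @koszul_low_degree g d (kostop f g) (leqnn g) dg.
- exact/chain_kostop.
- apply: (pred_case (Q := fun j => chain g j _ _)) => j gj.
  suff K I : is_ideal I -> (forall l, (l < g)%N -> I (x l * f)) ->
      chain g j I (kosd x g (kostop f g)) by exact: K.
  by rewrite gj; exact: kosd_kostop.
move: Nu; rewrite (chain_eq0 (ltnSn g) Fu) kosd0 subr0.
by move/chain_kostop; apply.
Qed.

(* Valabrega-Valla: since the initial forms of the h_l are regular, an element
   of degree D in (h_l) is a combination of terms that all have degree >= D. *)
Lemma initial_ideal i D y : (i <= g)%N ->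
  lin h [set 0] (fun=> [set: A]) i y -> F D y ->
  lin h [set 0] (fun l => F (D - q l)%N) i y.
Proof.
elim: i D y => [//|i IHi] D y ig [a [b [Ja _ ->]]] FDy.
suff [a' [b' [Ja' Fb' e]]] : exists a' b', [/\ lin h [set 0] (fun=> [set: A]) i a',
    F (D - q i)%N b' & a + h i * b = a' + h i * b'].
  exists a', b'; split=> //; apply: IHi (ltnW ig) Ja' _.
  have -> : a' = a + h i * b - h i * b' by rewrite e addrK.
  apply: is_idealB => //.
  by apply: filtration_le (FM (filtration_h ig) Fb'); lia.
have idJ : is_ideal (lin h [set 0] (fun=> [set: A]) i).
  exact: (lin_ideal _ (set0_ideal A)).
(* The order of the last coefficient is raised one step at a time. *)
suff: forall m, (m <= D - q i)%N -> exists a' b', [/\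
    lin h [set 0] (fun=> [set: A]) i a', F m b' & a + h i * b = a' + h i * b'].
  by apply.
elim=> [|m IHm] mD; first by exists a, b; rewrite F0.
have [a' [b' [Ja' Fb' e]]] := IHm (ltnW mD).
have Fh : F (m + q i)%N (h i * b').
  by rewrite addnC; apply: FM => //; exact: filtration_h.
have Fa' : F (m + q i)%N a'.
  have -> : a' = a + h i * b - h i * b' by rewrite e addrK.
  by apply: is_idealB => //; apply: filtration_le FDy; lia.
have Nb' : N i m b'.
  apply: nzd => //; have -> : h i * b' = (a + h i * b) - a' by rewrite e addrC addKr.
  apply: is_idealB => //.
    by apply: sub_lin_filtration; apply: filtration_le FDy; lia.
  apply: lin_sub (IHi _ _ (ltnW ig) Ja' Fa') => [_ ->|l _ t //].
  exact: (is_ideal0 (idF _)).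
(* Modulo F_(m+1), b' is a combination of the earlier h_l; its product with h_i is moved into a'. *)
have [c [Fc b'c]] := (linP _ _ _ _ _).1 Nb'.
exists (a' + h i * (\sum_(l < i) h l * c l)), (b' - \sum_(l < i) h l * c l).
split=> //; last by rewrite mulrBr -addrA (addrC (h i * _)) subrK.
apply: is_idealD => //; apply: is_idealM => //; apply/linP; exists c.
by rewrite subrr.
Qed.

(** * Elements multiplying a step of the filtration into J *)

Let J := lin h [set 0] (fun=> [set: A]) g.

(** Induction on k: x_l y multiplies F_(k-1) into J, so it lies in J + F_(e+1). Hence if y - j is in
    F_d with d < e, its class is in the socle modulo the initial forms, in too low a degree to be
    nonzero, and y lies in J + F_(d+1). *)
Lemma colon_filtration k e y : (e + k + g <= (\sum_(l < g) q l).+1)%N ->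
  (forall t, F k t -> J (y * t)) -> exists2 j, J j & F e (y - j).
Proof.
have idJ : is_ideal J.
  exact: (lin_ideal _ (set0_ideal A)).
elim: k e y => [|k IHk] e y ek Jy.
  by exists y; rewrite ?subrr; [rewrite -[y]mulr1; apply: Jy; rewrite F0|exact: is_ideal0].
suff: forall d, (d <= e)%N -> exists2 j, J j & F d (y - j) by apply.
elim=> [|d IHd] de; first by exists 0; [exact: is_ideal0|rewrite F0].
have [j Jj Ff] := IHd (ltnW de).
suff: N g d (y - j).
  case/linP=> b [_ Fb]; exists (j + \sum_(l < g) h l * b l).
    by apply: is_idealD => //; apply/linP; exists b; rewrite subrr.
  by rewrite opprD addrA.
apply: socle_low_degree => //; first lia.
move=> l lg; have [|s Fs|j' Jj' Ff'] := IHk e.+1 (y * x l); first lia.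
  by rewrite -mulrA; apply: Jy; rewrite -add1n; apply: FM => //; exact: xF.
pose r := x l * (y - j) - (y * x l - j').
have Jr : J r.
  have -> : r = j' - x l * j by rewrite /r; ring.
  by apply: is_idealB => //; exact: is_idealM.
have -> : x l * (y - j) = r + (y * x l - j') by rewrite subrK.
have Fr : F d.+1 r.
  apply: is_idealB => //; first by rewrite -add1n; apply: FM => //; exact: xF.
  by apply: filtration_le Ff'; lia.
apply: is_idealD => //.
  apply: lin_sub (initial_ideal (leqnn g) Jr Fr) => [_ ->|k0 _ t //].
  exact: (is_ideal0 (idF _)).
by apply: sub_lin_filtration; apply: filtration_le Ff'; lia.
Qed.

(** Choose j in J with y - j in F_M. Then (y - j) w lies in J and in F_(M+k), so its coefficients
    have order at least M + k - q_l >= k. *)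
Lemma colon_mul_filtration k M y w :
  (forall i, (i < g)%N -> (q i <= M)%N) ->
  (M + k + g <= (\sum_(l < g) q l).+1)%N ->
  (forall t, F k t -> J (y * t)) -> F k w ->
  lin h [set 0] (fun=> F k) g (y * w).
Proof.
move=> qM Mk Jy Fw.
have [j Jj Ff] := colon_filtration Mk Jy.
have id0 := set0_ideal A.
have -> : y * w = j * w + (y - j) * w by ring.
apply: is_idealD; first exact: lin_ideal.
  have [b [_ /eqP]] := (linP _ _ _ _ _).1 Jj; rewrite subr_eq0 => /eqP ->.
  apply/linP; exists (fun l => b l * w); split=> [l _|]; first exact: is_idealM.
  by apply/eqP; rewrite subr_eq0 mulr_suml; apply/eqP/eq_bigr => l _; rewrite mulrA.
have Jf : J ((y - j) * w).
  rewrite mulrBl [j * w]mulrC; apply: is_idealB; [exact: lin_ideal|exact: Jy|].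
  by apply: is_idealM => //; exact: lin_ideal.
apply: lin_sub (initial_ideal (leqnn g) Jf (FM Ff Fw)) => // l lg.
by apply: filtration_le; have := qM l lg; lia.
Qed.

End Socle.

(** * The associated graded ring *)

Section Graded.
Local Open Scope quotient_scope.
Variables (R : comNzRingType) (p : idealr R).
Local Notation P := (ideal_pow [set` p]).
Local Notation gpi := (\pi_{ideal_quot (@gr_ker R p)}).

Lemma ideal_pow_le d e : (d <= e)%N -> P e `<=` P d.
Proof.
move=> /subnKC <-; elim: (e - d)%N => [|n IHn]; first by rewrite addn0.
by rewrite addnS; apply: subset_trans IHn; exact: ideal_powS.
Qed.

Lemma gr_pi_eq (v w : rees p) :
  (forall i, P i.+1 ((val v)`_i - (val w)`_i)) <-> gpi v = gpi w.
Proof.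
split=> [h|/eqP]; [apply/eqP|]; rewrite -Quotient.idealrBE.
  by apply/asboolP => i; rewrite rmorphB coefB; exact: h.
by move=> /asboolP h i; have := h i; rewrite rmorphB coefB.
Qed.

Lemma rees_monomial d r : P d r -> val (insubd (0 : rees p) (r *: 'X^d)) = r *: 'X^d.
Proof.
move=> Pr; rewrite insubdK //; apply/asboolP => i.
rewrite coefZ coefXn; case: eqVneq => [->|_]; first by rewrite mulr1.
by rewrite mulr0; exact: is_ideal0 (ideal_powP _ _).
Qed.

Lemma gr_class_eq0 d r : P d.+1 r -> gr_class p d r = 0.
Proof.
move=> Pr; rewrite -[0](raddf0 gpi).
apply/gr_pi_eq => i; rewrite (rees_monomial (ideal_powS Pr)) raddf0 coef0 subr0.
rewrite coefZ coefXn; case: eqVneq => [->|_]; first by rewrite mulr1.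
by rewrite mulr0; exact: is_ideal0 (ideal_powP _ _).
Qed.

Lemma gr_classD d r t : P d r -> P d t ->
  gr_class p d (r + t) = gr_class p d r + gr_class p d t.
Proof.
move=> Pr Pt; rewrite -rmorphD; congr (gpi _); apply: val_inj.
rewrite rmorphD /= !rees_monomial ?scalerDl //.
exact: (is_idealD (ideal_powP _ _)).
Qed.

Lemma gr_classM d e r t : P d r -> P e t ->
  gr_class p (d + e) (r * t) = gr_class p d r * gr_class p e t.
Proof.
move=> Pr Pt; rewrite -rmorphM; congr (gpi _); apply: val_inj.
rewrite rmorphM /= !rees_monomial //; last exact: ideal_powM.
by rewrite -scalerAl -scalerAr scalerA exprD.
Qed.

Section InitialForms.
Variable z : seq R.
Local Notation q := (fun l => p_order p z`_l).
Local Notation N i d := (lin (nth 0 z) (P d.+1) (fun l => P (d - q l)%N) i).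
Local Notation zs := [seq initial_form p r | r <- z].

Hypotheses (zq : forall i, (i < size z)%N -> P (q i) z`_i) (zreg : regular_seq zs).

Let nth_initial l : (l < size z)%N -> zs`_l = gr_class p (q l) z`_l.
Proof. exact: nth_map. Qed.

(** Membership in N_i gives membership in the ideal of the previous initial forms; after
    cancellation there, the way back goes through representatives in the Rees ring. *)
Lemma initial_form_nzd i d f : (i < size z)%N -> P d f ->
  N i (d + q i)%N (z`_i * f) -> N i d f.
Proof.
move=> iz Pf Nzf; have Pid n := ideal_powP [set` p] n.
have Nid n : is_ideal (N i n) by apply: lin_ideal.
have [/(_ i (gr_class p d f))] := zreg; rewrite size_map => /(_ iz) zn _.
have sub_take l : (l < i)%N -> ideal_gen [set` take i zs] (gr_class p (q l) z`_l).
  move=> li; have lz := ltn_trans li iz; apply: sub_ideal_gen => /=.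
  rewrite -nth_initial // -(nth_take 0 li) mem_nth // size_takel // size_map.
  exact: ltnW.
have {zn Nzf} : ideal_gen [set` take i zs] (gr_class p d f).
  apply: zn; rewrite nth_initial // -gr_classM //; last exact: zq.
  have Eid := ideal_genP [set` take i zs].
  (* [gr_class] is additive only on the power of p of its degree, so this power is kept in the
     ideal. *)
  rewrite addnC; suff: [set y | P (d + q i)%N y /\
      ideal_gen [set` take i zs] (gr_class p (d + q i) y)] (z`_i * f) by case.
  apply: lin_min Nzf => [|y Py|l b li Pb].
  - split=> [|x y [Px Ex] [Py Ey]|a x [Px Ex]] /=.
    + have -> : gr_class p (d + q i) 0 = 0 by apply: gr_class_eq0; exact: is_ideal0.
      by split; [exact: (is_ideal0 (Pid _))|exact: (is_ideal0 Eid)].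
    + by rewrite gr_classD //; split; [exact: (is_idealD (Pid _))|exact: (is_idealD Eid)].
    + rewrite -{2}[(d + q i)%N]add0n gr_classM //.
      by split; [exact: (is_idealM _ (Pid _))|exact: (is_idealM _ Eid)].
  - rewrite /= gr_class_eq0 //; split; [exact: ideal_powS|].
    exact: (is_ideal0 Eid).
  - have lz := ltn_trans li iz; have Pz := zq lz.
    have [ql|ql] := leqP (q l) (d + q i).
      rewrite /= -[in P _](subnKC ql); split; first exact: ideal_powM.
      rewrite -[X in gr_class _ X](subnKC ql) gr_classM // mulrC.
      by apply: (is_idealM _ Eid); exact: sub_take.
    (* The subtraction truncates here, but the class in degree d + q_i vanishes. *)
    have Pzb : P (d + q i).+1 (z`_l * b).
      by rewrite mulrC; apply: (is_idealM _ (Pid _)); exact: ideal_pow_le ql _ Pz.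
    rewrite /= gr_class_eq0 //; split; [exact: ideal_powS|exact: (is_ideal0 Eid)].
(* An ideal of gr containing the previous initial forms, from which the condition on f is read off
   in degree d. *)
pose E := [set y | exists2 w : rees p, gpi w = y & forall n, N i n (val w)`_n].
have Eid : is_ideal E.
  split=> [|_ _ [v <- Nv] [w <- Nw]|y _ [w <- Nw]].
  - exists 0; first by rewrite raddf0.
    by move=> n; rewrite raddf0 coef0; exact: (is_ideal0 (Nid n)).
  - exists (v + w); first by rewrite raddfD.
    by move=> n; rewrite raddfD coefD; exact: (is_idealD (Nid n)).
  - pose v : rees p := repr (y : {ideal_quot (@gr_ker R p)}).
    have vy : gpi v = y by exact: reprK.
    exists (v * w); first by rewrite -vy; exact: rmorphM.
    move=> n; rewrite rmorphM coefM.
    apply: (big_ind _ (is_ideal0 (Nid n))) => [b c|j _]; first exact: (is_idealD (Nid n)).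
    have /asboolP Py := valP v.
    rewrite -[in N i _](subnKC (ltn_ord j : (j <= n)%N)).
    apply: lin_filtrationM => //; first exact: ideal_powS.
    by move=> c e a b; exact: ideal_powM.
have ES : [set` take i zs] `<=` E.
  have zsi : size (take i zs) = i by rewrite size_takel // size_map ltnW.
  move=> y /= /(nthP 0) [l]; rewrite zsi => li <-.
  have lz := ltn_trans li iz.
  rewrite nth_take // nth_initial //; exists (insubd 0 (z`_l *: 'X^(q l))) => // n.
  rewrite (rees_monomial (zq lz)) coefZ coefXn; apply: lin_gen => //.
  case: eqVneq => [->|_]; last exact: is_ideal0.
  by rewrite subnn.
move=> /(ideal_gen_min Eid ES) [w /gr_pi_eq /(_ d) wf Nw].
have Nwd := Nw d; move: wf.
rewrite (rees_monomial Pf) coefZ coefXn eqxx mulr1 => wf.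
have -> : f = (val w)`_d - ((val w)`_d - f) by rewrite opprB addrC subrK.
apply: (is_idealB (Nid d)) => //; apply: sub_lin wf => l _; exact: is_ideal0.
Qed.

End InitialForms.

(** Without an order, r lies in every power of p, and the default degree 0 gives the class zero. *)
Lemma p_orderP (r : R) : initial_form p r <> 0 -> P (p_order p r) r.
Proof.
rewrite /initial_form /p_order.
case: xgetP => [q _ [Pq _]//|noq] nz; exfalso; apply: nz.
have Pr n : P n r.
  elim: n => // n Pn; apply: contrapT => nPn; exact: (noq n).
exact: gr_class_eq0.
Qed.

(** A zero initial form would be a nonzerodivisor only modulo the unit ideal, which regularity
    excludes. *)
Lemma initial_form_order (z : seq R) : regular_seq [seq initial_form p r | r <- z] ->
  forall i, (i < size z)%N -> P (p_order p z`_i) z`_i.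
Proof.
move=> [zn z1] i iz; apply: p_orderP => zi0; apply: z1.
apply/seteqP; split=> // y _; rewrite -[y]mulr1; apply: (is_idealM _ (ideal_genP _)).
have /zn : (i < size [seq initial_form p r | r <- z])%N by rewrite size_map.
rewrite (nth_map 0) // zi0 => /(_ 1).
rewrite mul0r => /(_ (is_ideal0 (ideal_genP _))).
apply: (ideal_gen_min (ideal_genP _)).
move=> x /= /mem_take xz; exact: (@sub_ideal_gen _ _ x xz).
Qed.

End Graded.

(** * Extension and contraction along R -> R_p *)

Section Extension.
Variables (R : comNzRingType) (p : prime_idealr R).
Local Notation A := (loc p).
Local Notation frac := Defs.frac.
Local Notation P := (ideal_pow [set` p]).
Implicit Types (I B : set R) (D : nat -> set R) (r : R) (c : loc_den p).

Lemma loc_ofD r t : loc_of p (r + t) = loc_of p r + loc_of p t.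
Proof. by rewrite [RHS]frac_add; apply: fracW => /=; ring. Qed.

Lemma loc_ofM r t : loc_of p (r * t) = loc_of p r * loc_of p t.
Proof. by rewrite [RHS]frac_mul; apply: fracW => /=; ring. Qed.

Lemma frac_split r c : frac (r, c) = loc_of p r * frac (1, c).
Proof. by rewrite [RHS]frac_mul; apply: fracW => /=; ring. Qed.

Lemma frac_unit c : loc_of p (val c) * frac (1, c) = 1.
Proof. by rewrite -frac_split; apply: fracW => /=; ring. Qed.

(** For an ideal I this is I R_p, by common denominators; see [ext_gen]. *)
Definition ext I : set A := [set x | exists r c, x = frac (r, c) /\ I r].

Lemma ext_loc_of I r : I r -> ext I (loc_of p r).
Proof. by move=> Ir; exists r, (locd1 p). Qed.

(** The factor u appears because equal fractions agree only up to a factor outside p. *)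
Lemma ext_frac I r c : is_ideal I ->
  ext I (frac (r, c)) <-> exists u : loc_den p, I (val u * r).
Proof.
move=> idI; split=> [[r' [c' [/fracP [u /= e] Ir']]]|[u Iur]].
  exists (locdM u c') => /=.
  have -> : val u * val c' * r = val u * val c * r' +
    val u * (r * val c' - r' * val c) by ring.
  by rewrite e addr0; exact: is_idealM.
exists (val u * r), (locdM u c); split=> //.
by apply: fracW => /=; ring.
Qed.

Lemma ext_ideal I : is_ideal I -> is_ideal (ext I).
Proof.
move=> idI; split=> [|_ _ [r [c [-> Ir]]] [t [d [-> It]]]|a _ [r [c [-> Ir]]]].
- exact: ext_loc_of (is_ideal0 idI).
- exists (r * val d + t * val c), (locdM c d); split; first exact: frac_add.
  by apply: is_idealD => //; rewrite mulrC; exact: is_idealM.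
- elim/frac_ind: a => -[a d]; exists (a * r), (locdM d c).
  by split; [exact: frac_mul | exact: is_idealM].
Qed.

Lemma ext_gen I : is_ideal I -> ideal_gen (loc_of p @` I) = ext I.
Proof.
move=> idI; apply/seteqP; split.
  apply: ideal_gen_min; first exact: ext_ideal.
  by move=> _ [r Ir <-]; exact: ext_loc_of.
move=> _ [r [c [-> Ir]]]; rewrite frac_split mulrC.
apply: (is_idealM _ (ideal_genP _)); apply: sub_ideal_gen; by exists r.
Qed.

Lemma extT : ext [set: R] = [set: A].
Proof.
apply/seteqP; split=> // x _; elim/frac_ind: x => -[r c].
by exists r, c.
Qed.

Lemma ext0 : ext [set 0] `<=` [set 0].
Proof. by move=> _ [_ [c [-> ->]]]; apply: fracW => /=; ring. Qed.

Lemma ext_sub I B : I `<=` B -> ext I `<=` ext B.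
Proof. by move=> IB _ [r [c [-> /IB Br]]]; exists r, c. Qed.

Lemma ext_mul I B E a b : (forall r t, I r -> B t -> E (r * t)) ->
  ext I a -> ext B b -> ext E (a * b).
Proof.
move=> IB [r [c [-> Ir]]] [t [d [-> Bt]]]; exists (r * t), (locdM c d).
by split; [exact: frac_mul | exact: IB].
Qed.

Lemma ext_lin (h : nat -> R) B D i y : is_ideal B -> (forall l, is_ideal (D l)) ->
  ext (lin h B D i) y <->
  lin (fun l => loc_of p (h l)) (ext B) (fun l => ext (D l)) i y.
Proof.
move=> idB idD; elim: i y => [//|i IHi] y /=; split.
  move=> [_ [c [-> [a [b [ha hb ->]]]]]]; exists (frac (a, c)), (frac (b, c)).
  split; [by apply/IHi; exists a, c|by exists b, c|].
  by rewrite frac_split loc_ofD loc_ofM mulrDl -mulrA -!frac_split.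
move=> [a [b [/IHi [r [c [-> hr]]] [t [d [-> ht]]] ->]]].
exists (val d * r + h i * (val c * t)), (locdM c d); split.
  rewrite [_ * _ in LHS]frac_mul [_ + _ in LHS]frac_add.
  by apply: fracW => /=; ring.
exists (val d * r), (val c * t); split=> //; last exact: is_idealM.
by apply: is_idealM => //; exact: lin_ideal.
Qed.

(** * Symbolic powers as contractions *)

Lemma symbolic_powE k r : symbolic_pow p k r <-> ext (P k) (loc_of p r).
Proof. by rewrite -(ext_gen (ideal_powP [set` p] k)). Qed.

Lemma symbolic_powP k r :
  symbolic_pow p k r <-> exists u : loc_den p, P k (val u * r).
Proof.
apply: (iff_trans (symbolic_powE k r)).
exact: ext_frac (ideal_powP [set` p] k).
Qed.

Lemma symbolic_pow_ideal k : is_ideal (symbolic_pow p k).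
Proof.
have [E0 ED EM] := ext_ideal (ideal_powP [set` p] k).
split=> [|x y /symbolic_powE Ex /symbolic_powE Ey|a x /symbolic_powE Ex];
  apply/symbolic_powE; rewrite ?loc_ofD ?loc_ofM //; [exact: ED|exact: EM].
Qed.

Lemma symbolic_pow_sat k (u : loc_den p) r :
  symbolic_pow p k (val u * r) -> symbolic_pow p k r.
Proof.
by move=> /symbolic_powP [v]; rewrite mulrA => h; apply/symbolic_powP; exists (locdM v u).
Qed.

Lemma symbolic_pow_le k l : (k <= l)%N -> symbolic_pow p l `<=` symbolic_pow p k.
Proof.
move=> kl r /symbolic_powP [u Pu]; apply/symbolic_powP; exists u.
exact: ideal_pow_le kl _ Pu.
Qed.

Lemma prime_is_ideal : is_ideal [set` p].
Proof.
split=> /=; [exact: idealr0|by move=> x y; exact: rpredD|].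
by move=> a x; exact: idealMr.
Qed.

Lemma ideal_pow1_sub : P 1 `<=` [set` p].
Proof.
apply: ideal_gen_min; first exact: prime_is_ideal.
by move=> _ [a _ [b pb <-]]; exact: idealMr.
Qed.

Lemma symbolic_pow_sub k : (0 < k)%N -> symbolic_pow p k `<=` [set` p].
Proof.
move=> k0 r /symbolic_powP [u Pu].
have /= := ideal_pow1_sub (ideal_pow_le k0 Pu).
by rewrite prime_idealrM (negPf (valP u)).
Qed.

(** * Maximal ideal and dimension of R_p *)

Lemma ext_prime_maximal : is_maximal (ext [set` p]).
Proof.
have idp := ext_ideal prime_is_ideal; split=> // [E|E idE pE].
  have : ext [set` p] 1 by rewrite E.
  move=> /(ext_frac 1 (locd1 p) prime_is_ideal) [u /=].
  by rewrite mulr1 (negPf (valP u)).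
have [|nEp] := pselect (E `<=` ext [set` p]); first by left; apply/seteqP.
right; apply/seteqP; split=> // y _.
have [x Ex nx] : exists2 x, E x & ~ ext [set` p] x.
  apply: contrapT => nx; apply: nEp => x Ex; apply: contrapT => npx.
  by apply: nx; exists x.
elim/frac_ind: x Ex nx => -[r c] Ex nx.
have rp : r \notin p by apply/negP => rp; apply: nx; exists r, c.
(* As r is outside p, r / c is a unit with inverse c / r. *)
suff <- : y * frac (val c, Sub r rp) * frac (r, c) = y by exact: is_idealM.
rewrite -mulrA [_ * frac (r, c)]frac_mul -[RHS]mulr1; congr (_ * _).
by apply: fracW => /=; ring.
Qed.

Definition contraction (Q : prime_idealr A) : {pred R} := [pred r | loc_of p r \in Q].

Lemma contraction_idealr Q : idealr_closed (contraction Q).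
Proof.
split=> [||a u v]; rewrite !inE; first exact: idealr0.
  by rewrite (_ : loc_of p 1 = 1) ?idealr1.
by move=> Qu Qv; rewrite loc_ofD loc_ofM; apply: rpredD => //; exact: idealMr.
Qed.

HB.instance Definition _ Q := isIdealr.Build R (contraction Q) (contraction_idealr Q).

Lemma contraction_prime Q : prime_idealr_closed (contraction Q).
Proof. by move=> u v; rewrite !inE loc_ofM prime_idealrM. Qed.

HB.instance Definition _ Q :=
  isPrimeIdealrClosed.Build R (contraction Q) (@contraction_prime Q).

Lemma contraction_sub Q : [set` contraction Q] `<=` [set` p].
Proof.
move=> r /= Qr; apply: contraT => rp.
by have := idealMr (frac (1, Sub r rp)) Qr; rewrite mulrC (frac_unit (Sub r rp)) idealr1.
Qed.

(** A fraction is a unit times its numerator, so inclusions of primes of R_p are visible on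
    numerators. *)
Lemma contraction_inj Q Q' :
  [set` contraction Q] `<=` [set` contraction Q'] -> [set` Q] `<=` [set` Q'].
Proof.
move=> QQ' x; elim/frac_ind: x => -[r c] /= Qx.
have : r \in contraction Q'.
  apply: QQ'; rewrite /= inE; have := idealMr (loc_of p (val c)) Qx.
  by rewrite frac_split mulrCA frac_unit mulr1.
by rewrite inE frac_split mulrC; exact: idealMr.
Qed.

Lemma chain_le_height g n (c : nat -> prime_idealr A) :
  has_height p g -> prime_chain c n -> (n <= g)%N.
Proof.
move=> [_ hg] cn.
(* The contracted chain may end below p, so its last term is replaced by p. The last inclusion stays
   strict because p contains the term replaced. *)
pose c' i : prime_idealr R := if (i < n)%N then (contraction (c i) : prime_idealr R) else p.
apply: (hg c'); last by rewrite /c' ltnn.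
move=> i ilt; have [cs cns] := cn i ilt; rewrite /c' ilt.
have sub r : r \in contraction (c i) -> r \in contraction (c i.+1) by exact: cs.
have nsub : ~ ([set` contraction (c i.+1)] `<=` [set` contraction (c i)]).
  by move/contraction_inj.
have [_|_] := ltnP i.+1 n; first by split.
split=> [r /sub|]; first exact: contraction_sub.
by move=> psub; apply: nsub; apply: subset_trans psub; exact: contraction_sub.
Qed.

(** A regular system of parameters has dim R_p <= g elements; the default value of [nth] pads it
    with zeros to length g. *)
Lemma regular_local_generators g : has_height p g -> regular_local A ->
  exists x : nat -> A, (forall l, (l < g)%N -> ext (P 1) (x l)) /\
    forall y, ext (P 1) y -> exists a : nat -> A, y = \sum_(l < g) a l * x l.
Proof.
move=> hg [_ [m [[_ mloc] [xs [mxs [[c cxs] _]]]]]].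
have mE : m = ext [set` p] by rewrite -(mloc _ ext_prime_maximal).
have sg := chain_le_height hg cxs.
have P1 : [set` p] `<=` P 1 by move=> r; exact: ideal_pow1.
exists (nth 0 xs); split=> [l lg|y /(ext_sub ideal_pow1_sub)].
  apply: (ext_sub P1); rewrite -mE mxs.
  have [lx|lx] := ltnP l (size xs); last first.
    by rewrite nth_default //; exact: is_ideal0 (ideal_genP _).
  by apply: sub_ideal_gen; exact: mem_nth.
rewrite -mE mxs.
apply: (@ideal_gen_min _ [set y | exists a : nat -> A,
                                    y = \sum_(l < g) a l * xs`_l]).
  split=> [|_ _ [a ->] [b ->]|t _ [a ->]].
  - by exists (fun=> 0); rewrite big1 // => l _; rewrite mul0r.
  - exists (fun l => a l + b l); rewrite -big_split.
    by apply: eq_bigr => l _; rewrite mulrDl.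
  - by exists (fun l => t * a l); rewrite mulr_sumr; apply: eq_bigr => l _; rewrite mulrA.
move=> _ /= /(nthP 0) [i ix <-].
have ig : (i < g)%N := leq_trans ix sg.
exists (fun l => (l == i)%:R).
rewrite (bigD1 (Ordinal ig)) //= eqxx mul1r big1 ?addr0 // => l.
by rewrite -[l != Ordinal ig]/(l != i :> nat) => /negPf ->; rewrite mul0r.
Qed.

(** Yields the coefficients of order q_i - 1 that the Koszul argument wedges with. *)
Lemma ext_pow_generators g (x : nat -> A) d y :
  (forall y, ext (P 1) y -> exists a : nat -> A, y = \sum_(l < g) a l * x l) ->
  ext (P d.+1) y ->
  exists2 a : nat -> A, forall l, ext (P d) (a l) & y = \sum_(l < g) a l * x l.
Proof.
move=> xgen; have idd := ext_ideal (ideal_powP [set` p] d).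
pose E : set A := [set y | exists2 a : nat -> A, forall l, ext (P d) (a l) &
  y = \sum_(l < g) a l * x l].
have idE : is_ideal E.
  split=> [|_ _ [a Fa ->] [b Fb ->]|t _ [a Fa ->]].
  - exists (fun=> 0); first by move=> l; exact: is_ideal0.
    by rewrite big1 // => l _; rewrite mul0r.
  - exists (fun l => a l + b l); first by move=> l; exact: is_idealD.
    by rewrite -big_split; apply: eq_bigr => l _; rewrite mulrDl.
  - exists (fun l => t * a l); first by move=> l; exact: is_idealM.
    by rewrite mulr_sumr; apply: eq_bigr => l _; rewrite mulrA.
move=> [r [c [-> Pr]]]; rewrite frac_split mulrC; apply: (is_idealM _ idE).
have {Pr} : ideal_gen [set u * v | u in P d & v in [set` p]] r by [].
apply: (@ideal_gen_min _ (loc_of p @^-1` E)) => [|_ [u Pu [v pv <-]]].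
  split=> [|a b Ea Eb|a b Eb] /=; first exact: (is_ideal0 idE).
    by rewrite loc_ofD; exact: (is_idealD idE).
  by rewrite loc_ofM; exact: (is_idealM _ idE).
have [a va] := xgen _ (ext_loc_of (ideal_pow1 pv)).
rewrite /= loc_ofM va; exists (fun l => loc_of p u * a l).
  by move=> l; rewrite mulrC; apply: is_idealM => //; exact: ext_loc_of.
by rewrite mulr_sumr; apply: eq_bigr => l _; rewrite mulrA.
Qed.

End Extension.

Arguments ext {R} p I _.

(** * Links of symbolic powers *)

Section RegularSequence.
Variables (R : comNzRingType) (z : seq R).
Local Notation J i := (lin (nth 0 z) [set 0] (fun=> [set: R]) i).

Lemma lin_ideal_gen i : (i <= size z)%N -> ideal_gen [set` take i z] = J i.
Proof.
move=> iz; have idJ : is_ideal (J i) by exact: (lin_ideal _ (set0_ideal R)).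
have szi : size (take i z) = i by rewrite size_takel.
apply/seteqP; split.
  apply: ideal_gen_min => // y /= /(nthP 0) [l]; rewrite szi => li <-.
  rewrite nth_take // -[z`_l]mulr1.
  exact: (lin_gen _ (set0_ideal R)).
apply: lin_min => [|_ ->|l b li _]; first exact: ideal_genP.
  exact: is_ideal0 (ideal_genP _).
rewrite mulrC; apply: (is_idealM _ (ideal_genP _)); apply: sub_ideal_gen => /=.
by rewrite -(nth_take 0 li) mem_nth // szi.
Qed.

Lemma regular_seq_relation i (a : nat -> R) : regular_seq z -> (i <= size z)%N ->
  \sum_(l < i) z`_l * a l = 0 -> forall l, (l < i)%N -> J i (a l).
Proof.
move=> [zn _]; elim: i a => [//|i IHi] a iz; rewrite big_ord_recr /= => /eqP.
rewrite addr_eq0 => /eqP sa.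
have idJ n : is_ideal (J n) by exact: (lin_ideal _ (set0_ideal R)).
have /linP [c [_ /= /eqP]] : J i (a i).
  rewrite -(lin_ideal_gen (ltnW iz)); apply: (zn _ _ iz).
  rewrite (lin_ideal_gen (ltnW iz)).
  rewrite -[z`_i * a i]opprK -sa; apply: is_idealN => //.
  by apply/linP; exists a; rewrite subrr.
rewrite subr_eq0 => /eqP aE.
have JS : J i `<=` J i.+1 by move=> y Jy; exists y, 0; rewrite mulr0 addr0.
have zJ y : J i.+1 (z`_i * y).
  by exists 0, y; rewrite add0r; split=> //; exact: is_ideal0.
move=> l; rewrite ltnS leq_eqVlt => /predU1P [->|li].
  apply: JS; rewrite aE; apply/linP; exists c.
  by rewrite subrr.
(* Substituting a_i = sum z_l c_l leaves a shorter relation, with coefficients a_l + z_i c_l. *)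
have := IHi (fun l => a l + z`_i * c l) (ltnW iz).
rewrite (eq_bigr (fun l : 'I_i => z`_l * a l + z`_i * (z`_l * c l))); last first.
  by move=> k _; rewrite mulrDr mulrCA.
rewrite big_split /= -mulr_sumr -aE sa addNr => /(_ erefl l li) /JS Jl.
by rewrite -(addrK (z`_i * c l) (a l)); exact: (is_idealB (idJ i.+1) Jl (zJ _)).
Qed.

End RegularSequence.

(** M is the largest q_l; the other g - 1 terms are at least t. *)
Lemma sum_except_max g (q : nat -> nat) t : (0 < g)%N ->
  (forall i, (i < g)%N -> (t <= q i)%N) ->
  exists M, [/\ forall i, (i < g)%N -> (q i <= M)%N, (t <= M)%N &
                (M + g.-1 * t <= \sum_(l < g) q l)%N].
Proof.
move=> g0 tq; pose i0 := [arg max_(i > Ordinal g0) q i].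
have mx i : (i < g)%N -> (q i <= q i0)%N.
  by move=> ig; rewrite /i0; case: arg_maxnP => //= j _ /(_ (Ordinal ig) isT).
exists (q i0); split=> //; first exact: tq.
rewrite (bigD1 i0) //= leq_add2l.
have -> : (g.-1 * t = \sum_(i < g | i != i0) t)%N.
  by rewrite sum_nat_const cardC1 card_ord.
by apply: leq_sum => i _; exact: tq.
Qed.

(** * The square of a link *)

Section Main.
Variables (R : comNzRingType) (p : prime_idealr R) (g : nat) (z : g.-tuple R).
Local Notation P := (ideal_pow [set` p]).
Local Notation F d := (ext p (P d)).
Local Notation q := (fun l => p_order p z`_l).
Local Notation J := (ideal_gen [set` z]).

Hypotheses (hg : has_height p g) (Rp : regular_local (loc p)) (zreg : regular_seq z)
  (inreg : regular_seq [seq initial_form p r | r <- z]).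

Let zq i : (i < g)%N -> P (q i) z`_i.
Proof. by move=> ig; apply: initial_form_order => //; rewrite size_tuple. Qed.

Local Notation N i d := (lin (nth 0 z) (P d.+1) (fun l => P (d - q l)%N) i).

Let nzdR i d f : (i < g)%N -> P d f -> N i (d + q i)%N (z`_i * f) -> N i d f.
Proof.
move=> ig; apply: (initial_form_nzd (initial_form_order inreg) inreg).
by rewrite size_tuple.
Qed.

Let Pid d : is_ideal (P d) := ideal_powP [set` p] d.

Let JE : J = lin (nth 0 z) [set 0] (fun=> [set: R]) g.
Proof. by rewrite -lin_ideal_gen ?size_tuple // take_oversize ?size_tuple. Qed.

(** Take u outside p with u z_i in p^t. If q_i < t, this product vanishes in degree q_i of gr, so
    regularity puts u into N_i(0), which lies in p. *)
Lemma symbolic_pow_order t i : (0 < t)%N -> [set` z] `<=` symbolic_pow p t ->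
  (i < g)%N -> (t <= q i)%N.
Proof.
move=> t0 zt ig; have zi l : (l < g)%N -> symbolic_pow p t z`_l.
  by move=> lg; apply: zt; rewrite /= mem_nth ?size_tuple.
have /symbolic_powP [u Pu] := zi i ig.
rewrite leqNgt; apply/negP => qt; have /negP := valP u; apply.
have : N i 0 (val u).
  apply: nzdR => //; apply: sub_lin => [l _|]; first exact: is_ideal0.
  by rewrite mulrC; exact: ideal_pow_le qt _ Pu.
apply: (lin_min (prime_is_ideal p) (@ideal_pow1_sub _ p)) => l b li _.
rewrite mulrC; apply: (is_idealM _ (prime_is_ideal p)).
exact: symbolic_pow_sub t0 _ (zi l (ltn_trans li ig)).
Qed.

Let h l := loc_of p z`_l.

Let nzd i d f : (i < g)%N -> F d f ->
  lin h (F (d + q i).+1) (fun l => F (d + q i - q l)%N) i (h i * f) ->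
  lin h (F d.+1) (fun l => F (d - q l)%N) i f.
Proof.
move=> ig [r [c [-> Pr]]].
have idP e l : is_ideal (P (e - q l)%N) by [].
have idN e : is_ideal (N i e) by exact: lin_ideal.
rewrite [h i * _]frac_mul => /(ext_lin _ _ _ (Pid _) (idP _)).
move=> /(ext_frac _ _ (idN _)) [u /= Nu].
apply: (proj1 (ext_lin (nth 0 z) i _ (Pid d.+1) (idP d))).
apply/(ext_frac _ _ (idN _)); exists u.
apply: nzdR => //; first exact: is_idealM.
by rewrite mulrCA.
Qed.

(** As sum q_l >= M + (g - 1) s for the largest order M, the bound on k + g gives the degree
    estimate of [colon_filtration] with e = M. *)
Lemma colon_symbolic_square s k : (0 < g)%N -> (0 < k <= s)%N ->
  [set` z] `<=` symbolic_pow p s ->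
  (k + g <= (g.-1 * s).+1)%N ->
  let I := colon J (symbolic_pow p k) in ideal_pow I 2 = ideal_mul J I.
Proof.
move=> g0 /andP [k0 ks] zs kg I; have s0 := leq_trans k0 ks.
have [M [qM sM MS]] := sum_except_max g0 (fun i => symbolic_pow_order s0 zs).
have kM := leq_trans ks sM.
have Mk : (M + k + g <= (\sum_(l < g) q l).+1)%N.
  by move: MS; move: (\sum_(l < g) _)%N (g.-1 * s)%N kg => S T; lia.
have [x [xF xgen]] := regular_local_generators hg Rp.
have idF d : is_ideal (F d) := ext_ideal p (Pid d).
have F0 : F 0 = [set: loc p] by exact: extT.
have FS d : F d.+1 `<=` F d by apply: ext_sub; exact: ideal_powS.
have FM c d a b : F c a -> F d b -> F (c + d)%N (a * b).
  by apply: ext_mul => r t; exact: ideal_powM.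
have sq i : (i < g)%N -> (s <= q i)%N := symbolic_pow_order s0 zs.
have q0 i : (i < g)%N -> (0 < q i)%N by move=> /sq; exact: leq_trans.
have hx i : (i < g)%N -> exists2 a : nat -> loc p,
    forall l, F (q i).-1 (a l) & h i = \sum_(l < g) a l * x l.
  move=> ig; apply: ext_pow_generators => //; rewrite (prednK (q0 i ig)).
  by apply: ext_loc_of; exact: zq.
have idS := symbolic_pow_ideal p k.
have idJ : is_ideal J := ideal_genP _.
have JS : J `<=` symbolic_pow p k.
  apply: ideal_gen_min => // y /zs; exact: symbolic_pow_le.
have id0 := set0_ideal R; have idT := setT_ideal R.
have extJ D y : (forall l, is_ideal (D l)) ->
    lin h [set 0] (fun l => ext p (D l)) g y ->
    ext p (lin (nth 0 z) [set 0] D g) y.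
  move=> idD hy; apply/(ext_lin _ _ _ id0 idD).
  by apply: lin_sub hy => [_ ->|l _ t //]; exact: (is_ideal0 (ext_ideal p id0)).
have extJV y : ext p J y -> lin h [set 0] (fun=> [set: loc p]) g y.
  rewrite JE => /(ext_lin _ _ _ id0 (fun=> idT)).
  by apply: lin_sub => [|l _ //]; exact: ext0.
pose JA := lin h [set 0] (fun=> [set: loc p]) g.
have Icolon r : I r -> forall t, F k t -> JA (loc_of p r * t).
  move=> Ir _ [t [c [-> Pt]]]; apply: extJV.
  rewrite [_ * _]frac_mul; exists (r * t), (locdM (locd1 p) c); split=> //.
  by apply: Ir; apply/symbolic_powE; exact: ext_loc_of.
(* The image of r lies in JA + F_M; both summands are in F_k since k <= s <= q_l and k <= M. *)
have Isub r : I r -> symbolic_pow p k r.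
  move=> Ir;
  have [j Jj Fj] := colon_filtration idF F0 FS FM q0 xF hx nzd Mk (Icolon _ Ir).
  apply/symbolic_powE; rewrite -(subrK j (loc_of p r)); apply: is_idealD => //.
    exact: filtration_le FS _ _ kM _ Fj.
  apply: lin_min Jj => [//|_ ->|l b lg _]; first exact: is_ideal0.
  rewrite mulrC; apply: (is_idealM _ (idF k)); apply: ext_loc_of.
  by apply: ideal_pow_le (zq lg); exact: leq_trans ks (sq l lg).
have Jlin y : J y -> exists a : nat -> R, y = \sum_(l < g) z`_l * a l.
  by rewrite JE => /linP [a [_ /eqP]]; rewrite subr_eq0 => /eqP ->; exists a.
have Jcoef (a b : nat -> R) : \sum_(l < g) z`_l * a l = \sum_(l < g) z`_l * b l ->
    forall l, (l < g)%N -> J (a l - b l).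
  move=> ab l lg; rewrite JE.
  apply: (regular_seq_relation (a := fun l => a l - b l)) => //.
    by rewrite size_tuple.
  rewrite (eq_bigr (fun l : 'I_g => z`_l * a l - z`_l * b l)).
    by rewrite sumrB ab subrr.
  by move=> m _; rewrite mulrBr.
have Imul r w : I r -> symbolic_pow p k w -> exists2 b : nat -> R,
    forall l, (l < g)%N -> symbolic_pow p k (b l) & r * w = \sum_(l < g) z`_l * b l.
  move=> Ir Sw; have [a rw] := Jlin _ (Ir _ Sw).
  exists a => // l lg.
  have : ext p (lin (nth 0 z) [set 0] (fun=> P k) g) (loc_of p (r * w)).
    apply: extJ => //; rewrite loc_ofM.
    apply: (colon_mul_filtration idF F0 FS FM q0 xF hx nzd qM Mk (Icolon _ Ir)).
    exact/symbolic_powE.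
  have idL := lin_ideal (i := g) (nth 0 z) id0 (fun _ _ => Pid k).
  (* Clearing denominators gives u a_l congruent to b_l modulo J, with b_l in p^k. As J lies in
     p^(k), so does u a_l, and u cancels. *)
  move=> /(ext_frac _ _ idL) [u /linP [b [Pb /= /eqP]]].
  rewrite subr_eq0 rw mulr_sumr => /eqP urw.
  apply: (@symbolic_pow_sat _ _ _ u).
  rewrite -(subrK (b l) (val u * a l)); apply: (is_idealD idS).
    apply: JS; apply: (Jcoef (fun l => val u * a l)) => //.
    by rewrite -urw; apply: eq_bigr => m _; rewrite mulrCA.
  by apply/symbolic_powE; apply: ext_loc_of; exact: Pb.
have idI : is_ideal I.
  split=> [b _|x1 x2 I1 I2 b Sb|a x1 I1 b Sb].
  - by rewrite mul0r; exact: (is_ideal0 idJ).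
  - by rewrite mulrDl; apply: (is_idealD idJ); [exact: I1|exact: I2].
  - by rewrite -mulrA; apply: (is_idealM _ idJ); exact: I1.
have JI : J `<=` I by move=> y Jy b _; rewrite mulrC; exact: (is_idealM _ idJ).
apply/seteqP; split; last first.
  apply: ideal_gen_min => [|_ [a Ja [b Ib <-]]]; first exact: ideal_genP.
  by apply: sub_ideal_gen; exists a; [exact: (ideal_pow1 (JI _ Ja))|exists b].
apply: ideal_gen_min => [|_ [u Iu [v Iv <-]]]; first exact: ideal_genP.
have {}Iu : I u.
  by move: u Iu; apply: ideal_gen_min => // _ [a _ [b Ib <-]]; exact: (is_idealM _ idI).
(* The a_l lie in I: for w in p^(k) write u w = sum z_l b_l with b_l in p^(k). Comparing two
   expressions of u v w, a_l w is congruent modulo J to b_l v, which is in J. *)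
have [a uv] := Jlin _ (Iu _ (Isub _ Iv)).
rewrite uv; apply: (is_ideal_sum (f := fun l => z`_l * a l)) => [|l lg].
  exact: ideal_genP.
apply: sub_ideal_gen; exists z`_l.
  by apply: sub_ideal_gen; rewrite /= mem_nth ?size_tuple.
exists (a l) => // w Sw; have [b Sb uw] := Imul _ _ Iu Sw.
rewrite -(subrK (b l * v) (a l * w)); apply: (is_idealD idJ); last first.
  by rewrite mulrC; apply: Iv; exact: Sb.
apply: (Jcoef (fun l => a l * w) (fun l => b l * v)) => //.
under eq_bigr do rewrite mulrA.
under [RHS]eq_bigr do rewrite mulrA.
by rewrite -!mulr_suml -uv -uw mulrAC.
Qed.

End Main.

Theorem theorem2p4 (R : comNzRingType) (m : set R) (p : prime_idealr R)
    (g s : nat) (z : g.-tuple R) (J : set R) :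
  cohen_macaulay_local m ->
  has_height p g -> (2 <= g)%N ->
  regular_local (loc p) ->
  (2 <= s)%N ->
  J = ideal_gen [set` z] ->
  regular_seq z ->
  [set` z] `<=` symbolic_pow p s ->
  regular_seq [seq initial_form p r | r <- z] ->
  (3 <= g)%N \/ (g = 2%N /\ J `<=` symbolic_pow p s.+1) ->
  forall k : nat, (1 <= k <= s)%N ->
    let I := colon J (symbolic_pow p k) in
    ideal_pow I 2 = ideal_mul J I.
Proof.
move=> _ hg g2 Rp s2 -> zreg zs inreg gs k ks.
have g0 : (0 < g)%N := ltnW g2.
have [k0 k_le_s] := andP ks.
case: gs => [g3|[g_eq2 Js]].
  (* As k <= s, it suffices that g - 1 <= (g - 2) s, which holds for g >= 3 and s >= 2. *)
  by apply: (colon_symbolic_square hg Rp zreg inreg g0 ks zs); nia.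
(* For g = 2 the bound requires k to be less than the exponent, which is therefore taken to be s +
   1. *)
apply: (colon_symbolic_square hg Rp zreg inreg g0 (s := s.+1)).
- by rewrite k0 leqW.
- by move=> r zr; apply: Js; exact: sub_ideal_gen.
- by rewrite g_eq2; lia.
Qed.
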